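(* Let $\alpha,\gamma\in\mathbb{Z}$ with $\gamma>0$, $\alpha^\gamma\equiv7\bmod9$ and $\alpha\equiv-1\bmod3$. Then the group $$N_3=\langle a^3b^{-3},a^9,b^9,c^3\rangle$$ is a group of order $3^6$. Moreover, $W_3\cong G_3/N_3$ is the sole Sylow 3-subgroup of $W$, and is the group of order 81 generated by elements $a_0,b_0,c_0$ subject to the defining relations $$a_0^{c_0}=a_0^{-2},\quad b_0^{c_0}=b_0^4,\quad a_0^9=b_0^9=c_0^3=1,\quad a_0^3=b_0^3,\quad [a_0,b_0]=c_0.$$
   Context: Conventions: $x^y=y^{-1}xy$, ${}^y x=yxy^{-1}$, $[x,y]=x^{-1}y^{-1}xy$. $W=\langle X,Y,Z\mid X^Z=X^\alpha,\ {}^Z Y=Y^\alpha,\ Z^\gamma=[X,Y]\rangle$ (a finite group), $G=\langle A,B\mid A^{[A,B]}=A^{\alpha^\gamma},\ {}^{[A,B]}B=B^{\alpha^\gamma}\rangle$ (known to be finite and nilpotent), and $N$ is the kernel of the homomorphism $G\to W$, $A\mapsto X$, $B\mapsto Y$. $G_3$ is the Sylow 3-subgroup of $G$, $N_3=N\cap G_3$, and $W_3$ is a Sylow 3-subgroup of $W$. $a,b$ are the images of $A,B$ under the canonical projection $G\to G_3$, and $c=[a,b]$. *)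

(* Defs.v *)
From mathcomp Require Import all_boot all_order all_algebra all_fingroup.
From mathcomp Require Import all_solvable.

Set Implicit Arguments.
Unset Strict Implicit.
Unset Printing Implicit Defensive.

Import GroupScope.

Definition expgz (gT : groupType) (x : gT) (n : int) : gT :=
  match n with Posz k => x ^+ k | Negz k => x ^- k.+1 end.

Section Presentations.

(* [rel] stands for a system of relations in the named generators.  The group G
   is presented by generators and relations when the generators generate G,
   satisfy the relations, and G has the universal property against every
   group, finite or not.  MathComp's [G \isog Grp (...)] is not used because it
   tests only finite groups and does not name the generators. *)

Definition presented2
    (rel : forall H : groupType, H -> H -> Prop)
    (gT : finGroupType) (G : {group gT}) (x y : gT) : Prop :=
  [/\ G :=: <<[set x; y]>>,
      rel gT x y &
      forall (H : groupType) (x' y' : H), rel H x' y' ->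
        exists f : gT -> H,
          [/\ {in G &, {morph f : u v / u * v}}, f x = x' & f y = y']].

Definition presented3
    (rel : forall H : groupType, H -> H -> H -> Prop)
    (gT : finGroupType) (G : {group gT}) (x y z : gT) : Prop :=
  [/\ G :=: <<[set x; y; z]>>,
      rel gT x y z &
      forall (H : groupType) (x' y' z' : H), rel H x' y' z' ->
        exists f : gT -> H,
          [/\ {in G &, {morph f : u v / u * v}},
              f x = x', f y = y' & f z = z']].

End Presentations.

(* ^z y = z y z^-1 is y ^ (z^-1) in MathComp notation. *)
Definition relW (alpha : int) (gamma : nat)
    (H : groupType) (X Y Z : H) : Prop :=
  [/\ X ^ Z = expgz X alpha,
      Y ^ (Z^-1) = expgz Y alpha &
      Z ^+ gamma = [~ X, Y]].

Definition relG (delta : int) (H : groupType) (A B : H) : Prop :=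
  A ^ [~ A, B] = expgz A delta /\ B ^ ([~ A, B]^-1) = expgz B delta.

Definition relW3 (H : groupType) (a b c : H) : Prop :=
  [/\ a ^ c = a ^- 2, b ^ c = b ^+ 4,
      [/\ a ^+ 9 = 1, b ^+ 9 = 1 & c ^+ 3 = 1],
      a ^+ 3 = b ^+ 3 & [~ a, b] = c].

(* For nilpotent G, G = 'O_p(G) \x 'O_p^'(G) with 'O_p(G) the Sylow p-subgroup;
   this is the projection onto the first factor. *)
Definition sylow_proj (p : nat) (gT : finGroupType) (G : {group gT}) (x : gT)
    : gT :=
  divgr 'O_p(G) 'O_p^'(G) x.

(* Main.v *)
(** Write c = [a, b], let e be an inverse of d modulo a large power of 3 and put
    s(n) = 1 + e + ... + e^(n-1).  From a^c = a^d and b^(c^-1) = b^d one gets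
    (a^n)^b = a^s(n) c^n and (b^n)^a = b^s(n) c^(-n).  If moreover a^z = a^m,
    b^(z^-1) = b^m and c^z = c, then computing the conjugate of a by
    b^m = z b z^-1 in two ways gives a^(m' d^m k) b^k = 1 with k = s(m) - m and
    m m' = 1.  In G_3 one of z = c, z = c^-1 makes 27 the exact power of 3
    dividing k; in W_3 the element z = Z makes it 3.  Hence, for q = 27 or q = 3,
    a^q and b^q generate the same central subgroup, a^(3q) = c^q = 1, and every
    element is some a^i b^j c^k, so the order is at most 3q^3.  Equality holds as
    soon as a^q <> 1, which is seen on the permutation action on the cosets of
    <c>: in the coordinates (j, i) of the coset of b^j a^i, the maps a, b, c send
    (j, i) to (j, i + 1), (e^i (j + 1), d + ... + d^i) and (e j, d i). *)

Require Import Defs.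
From mathcomp Require Import all_boot all_order all_algebra all_fingroup.
From mathcomp Require Import all_solvable.
From mathcomp Require Import zify ring.

Set Implicit Arguments.
Unset Strict Implicit.
Unset Printing Implicit Defensive.

(** * Sums of powers *)

Definition geom (e n : nat) : nat := \sum_(i < n) e ^ i.

Lemma geom0 e : geom e 0 = 0.
Proof. exact: big_ord0. Qed.

Lemma geomS e n : geom e n.+1 = (1 + e * geom e n)%N.
Proof.
rewrite /geom big_ord_recl big_distrr /=; congr (_ + _)%N.
by apply: eq_bigr => i _; rewrite expnS.
Qed.

Lemma geomD e m n : geom e (m + n) = (geom e m + e ^ m * geom e n)%N.
Proof.
elim: m => [|m IHm]; first by rewrite geom0 mul1n.
by rewrite addSn !geomS IHm expnS; ring.
Qed.

Lemma leq_geom e n : (0 < e)%N -> (n <= geom e n)%N.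
Proof.
move=> e_gt0; elim: n => // n IHn; rewrite geomS.
by rewrite add1n ltnS (leq_trans IHn) // leq_pmull.
Qed.

Lemma expn_mod3 e n : e = 1 %[mod 3] -> e ^ n = 1 %[mod 3].
Proof. by move=> e1; rewrite -modnXm e1 modnXm exp1n. Qed.

(** With [e ^ m = 1 + 3 * x], cutting a sum of [3 * m] terms into three blocks multiplies the sum of
    [m] terms by [3 * (1 + 3 * (x + x ^ 2))]; induction on [k] follows. *)
Lemma geom_3adic e k n : e = 1 %[mod 3] -> (3 ^ k %| n)%N ->
  exists y, geom e n = (n + 3 ^ k.+1 * y)%N.
Proof.
move=> e1 /dvdnP[r ->]; rewrite mulnC.
elim: k => [|k [y IHk]].
  rewrite mul1n; elim: r => [|r [y IHr]]; first by exists 0; rewrite geom0.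
  have [x ex] : exists x, e = (1 + 3 * x)%N.
    by exists (e %/ 3)%N; rewrite {1}(divn_eq e 3) e1 addnC mulnC.
  exists (y + x * geom e r)%N; rewrite geomS {1}ex mulnDl mul1n {1}IHr.
  by ring.
have [x ex] : exists x, e ^ (3 ^ k * r) = (1 + 3 * x)%N.
  exists (e ^ (3 ^ k * r) %/ 3)%N.
  by rewrite {1}(divn_eq (e ^ (3 ^ k * r)) 3) expn_mod3 // addnC mulnC.
have -> : (3 ^ k.+1 * r = 3 ^ k * r + (3 ^ k * r + 3 ^ k * r))%N.
  by rewrite expnS; ring.
exists (y + r * (x + x ^ 2) + y * 3 * (x + x ^ 2))%N.
by rewrite !geomD ex IHk !expnS expn0; ring.
Qed.

(** Cubing [1 + 3 ^ k.+1 * y] gains one factor 3 in every nonconstant term. *)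
Lemma expn_3adic e k n : e = 1 %[mod 3] -> (3 ^ k %| n)%N ->
  e ^ n = 1 %[mod 3 ^ k.+1].
Proof.
move=> e1 /dvdnP[r ->]; rewrite mulnC expnM -modnXm.
suff -> : e ^ 3 ^ k = 1 %[mod 3 ^ k.+1] by rewrite modnXm exp1n.
elim: k {r} => [|k IHk]; first by rewrite expn1.
set x := e ^ 3 ^ k in IHk.
have k1 : (1 < 3 ^ k.+1)%N by rewrite -[1%N](expn0 3) ltn_exp2l.
have [y xE] : exists y, x = (1 + 3 ^ k.+1 * y)%N.
  exists (x %/ 3 ^ k.+1)%N; rewrite {1}(divn_eq x (3 ^ k.+1)) IHk modn_small //.
  by rewrite addnC mulnC.
have -> : e ^ 3 ^ k.+1 = (1 + 3 ^ k.+2 *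
    (y + y ^ 2 * 3 ^ k.+1 + 3 ^ k * (3 ^ k.+1 * y ^ 3)))%N.
  by rewrite expnSr expnM -/x xE !expnS expn0; ring.
by rewrite addnC mulnC modnMDl.
Qed.

(** The terms beyond the first [n %% 3 ^ k] sum to a multiple of [3 ^ k], by [geom_3adic]. *)
Lemma geom_modr e k n : e = 1 %[mod 3] ->
  geom e n = geom e (n %% 3 ^ k) %[mod 3 ^ k].
Proof.
move=> e1; rewrite {1}(divn_eq n (3 ^ k)) addnC; set m := n %% _.
have [y gE] := @geom_3adic e k (n %/ 3 ^ k * 3 ^ k) e1 (dvdn_mull _ (dvdnn _)).
rewrite geomD gE expnS; set q := n %/ _; set x := e ^ m.
have -> : geom e m + x * (q * 3 ^ k + 3 * 3 ^ k * y)
        = x * (q + 3 * y) * 3 ^ k + geom e m by ring.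
by rewrite modnMDl.
Qed.

(** Reducing at every step keeps the numbers small in the boolean checks. *)
Definition geom_mod (m e n : nat) : nat :=
  iter n (fun x => (1 + e * x) %% m) 0.

Lemma geom_modE m e n : geom e n = geom_mod m (e %% m) n %[mod m].
Proof.
elim: n => [|n IHn]; first by rewrite geom0.
rewrite geomS /geom_mod iterS -/(geom_mod m (e %% m) n) modn_mod.
by rewrite -modnDmr -modnMm IHn modnMm -modnMml modnDmr.
Qed.

(** For [q] a power of 3, this tests that [q] is the exact power of 3 dividing [geom e n - n]. *)
Definition geom_sub_exact (q e n : nat) : bool :=
  let r := geom_mod (3 * q) e n in
  (r == n %[mod q]) && (r != n %[mod 3 * q]).

(** As [3 * q] is a power of 3, [geom e n] modulo [3 * q] depends only on the residues of [e] and
    [n]. *)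
Lemma geom_sub_exactP q k e n : (0 < e)%N -> e = 1 %[mod 3] -> 3 * q = 3 ^ k ->
    geom_sub_exact q (e %% (3 * q)) (n %% (3 * q)) ->
  exists2 u, geom e n = n + q * u & coprime 3 u.
Proof.
move=> e_gt0 e1 qE; rewrite /geom_sub_exact; set r := geom_mod _ _ _.
rewrite modn_mod modn_dvdm ?dvdn_mull // => /andP[/eqP rn r'n].
have gr : geom e n = r %[mod 3 * q] by rewrite qE (@geom_modr e k) // geom_modE /r qE.
have /dvdnP[u uE] : q %| geom e n - n.
  rewrite -eqn_mod_dvd ?leq_geom //; apply/eqP; rewrite -rn.
  by rewrite -(modn_dvdm (geom e n) (dvdn_mull 3 (dvdnn q))) gr modn_dvdm ?dvdn_mull.
have gE : geom e n = n + q * u by rewrite mulnC -uE subnKC ?leq_geom.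
exists u => //; rewrite prime_coprime //; apply/negP => /dvdnP[v vE].
case/eqP: r'n; rewrite -gr gE vE.
have -> : n + q * (v * 3) = v * (3 * q) + n by ring.
by rewrite modnMDl.
Qed.

(** Together with [modn_div_iota], this reduces a claim about a class modulo [k] to a computation
    over the residues modulo [m] lying in it. *)
Lemma modn_modE m k n r : (k %| m)%N -> (r < k)%N -> n = r %[mod k] ->
  n %% m = (n %% m %/ k * k + r)%N.
Proof.
by move=> km rk nr; rewrite {1}(divn_eq (n %% m) k) modn_dvdm // nr (modn_small rk).
Qed.

Lemma modn_div_iota m k n : (0 < m)%N -> (k %| m)%N ->
  n %% m %/ k \in iota 0 (m %/ k).
Proof.
move=> m_gt0 km; have k_gt0 : 0 < k := dvdn_gt0 m_gt0 km.
by rewrite mem_iota ltn_divLR // divnK // ltn_mod.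
Qed.

Lemma mod9_mod3 e : e = 4 %[mod 9] -> e = 1 %[mod 3].
Proof. by move=> e4; rewrite -(@modn_dvdm 9 e 3) // e4. Qed.

Lemma mod9_gt0 e : e = 4 %[mod 9] -> 0 < e.
Proof. by case: e. Qed.

(* Both choices of n are needed: n = d fails if d = 25 modulo 27, and n = e fails
   if d = 7 modulo 27. *)
Lemma geom_sub_27 d e : d = 7 %[mod 9] -> e = 4 %[mod 9] ->
    d * e = 1 %[mod 81] ->
  exists2 n, n = d \/ n = e &
  exists2 u, geom e n = n + 27 * u & coprime 3 u.
Proof.
move=> d7 e4 de1.
have chk : all (fun j => all (fun i => let d' := j * 9 + 7 in let e' := i * 9 + 4 in
      ((d' * e') %% 81 == 1) ==> geom_sub_exact 27 e' d' || geom_sub_exact 27 e' e')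
    (iota 0 (81 %/ 9))) (iota 0 (81 %/ 9)) by vm_compute.
have := allP (allP chk _ (@modn_div_iota 81 9 d isT isT)) _
  (@modn_div_iota 81 9 e isT isT).
have dE := @modn_modE 81 9 d 7 isT isT d7.
have eE := @modn_modE 81 9 e 4 isT isT e4.
rewrite /= -dE -eE modnMm de1 => /orP val.
have val27 n := @geom_sub_exactP 27 4 e n (mod9_gt0 e4) (mod9_mod3 e4) erefl.
by case: val => /val27; [exists d; first left | exists e; first right].
Qed.

(** Only residues modulo 9 matter: 4 for [e], and 2, 5 or 8 for [n]. *)
Lemma geom_sub_3 e n : e = 4 %[mod 9] -> n = 2 %[mod 3] ->
  exists2 u, geom e n = n + 3 * u & coprime 3 u.
Proof.
move=> e4 n2.
have chk : all (fun i => geom_sub_exact 3 4 (i * 3 + 2)) (iota 0 (9 %/ 3)).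
  by vm_compute.
have := allP chk _ (@modn_div_iota 9 3 n isT isT).
have nE := @modn_modE 9 3 n 2 isT isT n2.
rewrite /= -nE -[X in geom_sub_exact _ X]/(4 %% 9) -e4 => val3.
exact: @geom_sub_exactP 3 2 e n (mod9_gt0 e4) (mod9_mod3 e4) erefl val3.
Qed.

(** In [d ^ n - 1 = (d - 1) * geom d n] with [n = 3 ^ r], the first factor is divisible by 3 exactly
    once and the second exactly [r] times. *)
Lemma expn_mod9_neq1 d r : d = 7 %[mod 9] -> d ^ 3 ^ r <> 1 %[mod 3 ^ r.+2].
Proof.
move=> d7 /eqP d1.
have d13 : d = 1 %[mod 3] by rewrite -(@modn_dvdm 9 d 3) // d7.
have [y gE] := @geom_3adic d r (3 ^ r) d13 (dvdnn _).
have dE : d = d %/ 9 * 9 + 7 by rewrite {1}(divn_eq d 9) d7.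
have powE n : d ^ n = 1 + (d - 1) * geom d n.
  elim: n => [|n IHn]; first by rewrite geom0 muln0.
  by rewrite expnS geomS IHn; nia.
move: d1; rewrite powE eqn_mod_dvd ?leq_addr // addKn gE {1}dE.
have -> : d %/ 9 * 9 + 7 - 1 = 3 * (3 * (d %/ 9) + 2) by lia.
have -> : 3 * (3 * (d %/ 9) + 2) * (3 ^ r + 3 ^ r.+1 * y)
    = 3 ^ r.+1 * ((3 * (d %/ 9) + 2) * (1 + 3 * y)).
  by rewrite expnS; ring.
rewrite (expnSr 3 r.+1) dvdn_pmul2l ?expn_gt0 // Euclid_dvdM //.
by case/orP=> /dvdnP[z]; lia.
Qed.

Import GroupScope.

Lemma expg_modl (gT : groupType) (x : gT) n i j :
  x ^+ n = 1 -> i = j %[mod n] -> x ^+ i = x ^+ j.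
Proof.
move=> xn ij; rewrite (divn_eq i n) (divn_eq j n) ij !expgD.
by rewrite !(mulnC _ n) !expgM xn !expg1n.
Qed.

(** * Pairs with a ^ c = a ^+ d and b ^ c^-1 = b ^+ d *)

Section MacdonaldPair.

Variables (gT : finGroupType) (a b c : gT) (d e N : nat).
Hypotheses (cE : [~ a, b] = c) (ac : a ^ c = a ^+ d) (bc : b ^ c^-1 = b ^+ d).
Hypotheses (aN : a ^+ N = 1) (bN : b ^+ N = 1) (de1 : d * e = 1 %[mod N]).

Lemma conjVa n : (a ^+ n) ^ c^-1 = a ^+ (e * n).
Proof.
apply: (conjg_inj c); rewrite conjgKV conjXg ac -expgM.
by apply: (expg_modl aN); rewrite mulnA -modnMml de1 modnMml mul1n.
Qed.

Lemma conjb n : (b ^+ n) ^ c = b ^+ (e * n).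
Proof.
apply: (conjg_inj c^-1); rewrite conjgK conjXg bc -expgM.
by apply: (expg_modl bN); rewrite mulnA -modnMml de1 modnMml mul1n.
Qed.

Lemma conj_ab : a ^ b = a * c.
Proof. by rewrite -cE commgEl mulKVg. Qed.

Lemma conj_ba : b ^ a = b * c^-1.
Proof. by rewrite -cE invg_comm commgEl mulKVg. Qed.

(** This is the expansion of the [n]-th power of [a * c]: moving [c] to the right past a power of
    [a] multiplies the exponent by [e]. *)
Lemma conjXab n : (a ^+ n) ^ b = a ^+ geom e n * c ^+ n.
Proof.
rewrite conjXg conj_ab; elim: n => [|n IHn]; first by rewrite geom0 !expg0 mulg1.
rewrite expgS {}IHn geomS expgD expg1 -conjVa conjgE invgK expgS.
by rewrite !mulgA mulgKV.
Qed.

Lemma conjXba n : (b ^+ n) ^ a = b ^+ geom e n * c ^- n.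
Proof.
rewrite conjXg conj_ba; elim: n => [|n IHn]; first by rewrite geom0 !expg0 invg1 mulg1.
rewrite expgS {}IHn geomS expgD expg1 -conjb conjgE expgSr invMg.
by rewrite !mulgA mulgK.
Qed.

Lemma conja_expb n : a ^ (b ^+ n) = a * (c ^+ n * b ^- geom e n * b ^+ n).
Proof.
have -> : a ^ (b ^+ n) = a * ((b ^+ n) ^ a)^-1 * b ^+ n.
  by rewrite !conjgE !invMg invgK !mulgA mulgV mul1g.
by rewrite conjXba invMg invgK !mulgA.
Qed.

Lemma conja_expc k n : (a ^+ n) ^ (c ^+ k) = a ^+ (d ^ k * n).
Proof.
elim: k => [|k IHk]; first by rewrite expg0 conjg1 mul1n.
by rewrite expgSr conjgM IHk conjXg ac -expgM expnS mulnA.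
Qed.

Lemma conjb_expVc k n : (b ^+ n) ^ (c ^- k) = b ^+ (d ^ k * n).
Proof.
elim: k => [|k IHk]; first by rewrite expg0 invg1 conjg1 mul1n.
by rewrite expgS invMg conjgM IHk conjXg bc -expgM expnS mulnA.
Qed.

(* Conjugate [a] by [z b z^-1 = b ^+ m] in two ways. *)
Lemma power_relation (z : gT) m m' k :
    a ^ z = a ^+ m -> b ^ z^-1 = b ^+ m -> c ^ z = c ->
    m * m' = 1 %[mod N] -> geom e m = (m + k)%N ->
  a ^+ (m' * d ^ m * k) * b ^+ k = 1.
Proof.
move=> az bz cz mm gE.
have aVz n : (a ^+ n) ^ z^-1 = a ^+ (m' * n).
  apply: (conjg_inj z); rewrite conjgKV conjXg az -expgM.
  by apply: (expg_modl aN); rewrite mulnA -modnMml mm modnMml mul1n.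
have cVz : (c ^+ m) ^ z^-1 = c ^+ m by rewrite conjXg -{1}cz conjgK.
have : a ^ (b ^+ m) = a ^+ (m' * (m + k)) * c ^+ m.
  have -> : b ^+ m = z * b * z^-1 by rewrite -bz conjgE invgK mulgA.
  by rewrite !conjgM az conjXab conjMg cVz aVz gE.
have -> : a ^+ (m' * (m + k)) = a * a ^+ (m' * k).
  by rewrite mulnDr expgD mulnC (expg_modl aN mm) expg1.
(* The second computation. Cancelling [a] leaves [c ^+ m * b ^- k = a ^+ (m' * k) * c ^+ m], and
   conjugation by [c ^+ m] brings in the factor [d ^ m]. *)
rewrite conja_expb gE -(mulgA a (a ^+ _)) => /mulgI.
rewrite expgD invMg !mulgA mulgKV => cb.
have -> : (m' * d ^ m * k = d ^ m * (m' * k))%N by ring.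
by rewrite -conja_expc conjgE -cb mulKg mulVg.
Qed.

End MacdonaldPair.

Lemma expg_coprime_eq1 (gT : finGroupType) (x : gT) m n :
  coprime m n -> x ^+ m = 1 -> x ^+ n = 1 -> x = 1.
Proof.
move=> /eqP co /eqP xm /eqP xn; apply/eqP; rewrite -order_eq1 -dvdn1 -co.
by rewrite dvdn_gcd !order_dvdn xm.
Qed.

Lemma order_pfactor (gT : finGroupType) (x : gT) p k : prime p ->
  x ^+ (p ^ k.+1) = 1 -> x ^+ (p ^ k) != 1 -> #[x] = (p ^ k.+1)%N.
Proof.
move=> p_pr xk1; rewrite -order_dvdn.
have : (#[x] %| p ^ k.+1)%N by rewrite order_dvdn xk1.
case/dvdn_pfactor=> // m; rewrite leq_eqVlt => /predU1P[-> //|lt_m ->].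
by rewrite dvdn_exp2l.
Qed.

Lemma card_cycleI_dvd (gT : finGroupType) (x : gT) (H : {group gT}) i j :
  #[x] = (3 ^ (j + i).+1)%N -> x ^+ (3 ^ j) \notin H ->
  (#|<[x]> :&: H| %| 3 ^ i)%N.
Proof.
move=> ox; apply: contraR => nI; have sI : <[x]> :&: H \subset <[x]> := subsetIl _ _.
have : (#|<[x]> :&: H| %| 3 ^ (j + i).+1)%N by rewrite -ox orderE cardSg.
case/dvdn_pfactor=> // m _ oI; rewrite oI dvdn_Pexp2l // -ltnNge in nI.
have oy : #[x ^+ (3 ^ j)] = (3 ^ i.+1)%N.
  by rewrite orderXdiv ox -addnS ?expnD ?mulKn ?expn_gt0 ?dvdn_mulr.
have sy : <[x ^+ (3 ^ j)]> \subset <[x]> by rewrite cycle_subG mem_cycle.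
have := cardSg_cyclic (cycle_cyclic x) sy sI.
by rewrite -orderE oy oI dvdn_exp2l // cycle_subG inE => /esym/andP[].
Qed.

Lemma inverse_mod u n : coprime u n -> exists v, (u * v = 1 %[mod n])%N.
Proof.
case: n => [|[|n]] co.
- by exists 1%N; move: co; rewrite /coprime gcdn0 => /eqP->.
- by exists 0; rewrite !modn1.
exists (u ^ (totient n.+2).-1)%N; rewrite -expnS prednK ?totient_gt0 //.
exact: Euler_exp_totient.
Qed.

(** * Central powers and exponents obtained from the power relation *)

Section PowerRelation.

Variables (gT : finGroupType) (a b c z : gT) (d e K r u m m' : nat).
Hypotheses (cE : [~ a, b] = c) (ac : a ^ c = a ^+ d) (bc : b ^ c^-1 = b ^+ d).
Hypotheses (d7 : (d = 7 %[mod 9])%N) (e4 : (e = 4 %[mod 9])%N).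
Hypotheses (aN : a ^+ (3 ^ K.+1) = 1) (bN : b ^+ (3 ^ K.+1) = 1).
Hypotheses (de1 : (d * e = 1 %[mod 3 ^ K.+1])%N) (mm1 : (m * m' = 1 %[mod 3 ^ K.+1])%N).
Hypotheses (az : a ^ z = a ^+ m) (bz : b ^ z^-1 = b ^+ m) (cz : c ^ z = c).
Hypotheses (gE : geom e m = (m + 3 ^ r.+1 * u)%N) (co_u : coprime 3 u).

Local Notation q := (3 ^ r.+1)%N.

Lemma coprime_m'd : coprime 3 (m' * d ^ m).
Proof.
have cod x y : (x * y = 1 %[mod 3])%N -> coprime 3 x.
  move=> xy; rewrite prime_coprime //; apply/negP=> /dvdnP[k kE].
  by move: xy; rewrite kE mulnAC modnMl.
rewrite coprimeMr coprimeXr ?andbT.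
  apply: (cod m' m); rewrite mulnC -(@modn_dvdm (3 ^ K.+1) (m * m') 3) ?mm1 ?modn_dvdm //;
  by rewrite expnS dvdn_mulr.
by rewrite (cod d 1%N) // muln1 -(@modn_dvdm 9 d 3) // d7.
Qed.

(** This is [power_relation] with [k = q * u]; the unit [u] is removed by raising to its inverse
    modulo [3 ^ K.+1]. *)
Lemma expb_expa_inv : a ^+ (q * (m' * d ^ m)) * b ^+ q = 1.
Proof.
have [u' uu] : exists u', (u * u' = 1 %[mod 3 ^ K.+1])%N.
  by apply: inverse_mod; rewrite coprimeXr // coprime_sym.
have := power_relation cE ac bc aN bN de1 az bz cz mm1 gE.
set v := (m' * d ^ m)%N => /eqP; rewrite -eq_invg_mul => /eqP avE.
have uq (x : gT) : x ^+ (3 ^ K.+1) = 1 -> x ^+ (q * u * u') = x ^+ q.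
  move=> xN; apply: (expg_modl xN).
  by rewrite -mulnA -modnMmr uu modnMmr muln1.
apply/eqP; rewrite -eq_invg_mul -(uq b bN) (expgM b) -avE expgVn -expgM.
have av : (a ^+ v) ^+ (3 ^ K.+1) = 1 by rewrite -expgM mulnC expgM aN expg1n.
apply/eqP; congr (_ ^-1).
by rewrite mulnC (expgM a v) -(uq _ av) -!expgM !mulnA.
Qed.

(** Since [m' * d ^ m] is invertible modulo [3 ^ K.+1], [a ^+ q] is a power of [b]. *)
Lemma commute_expa_b : commute (a ^+ q) b.
Proof.
have [v vv] : exists v, (m' * d ^ m * v = 1 %[mod 3 ^ K.+1])%N.
  by apply: inverse_mod; rewrite coprimeXr // coprime_sym coprime_m'd.
have /eqP := expb_expa_inv; rewrite -eq_invg_mul (canF_eq invgK) => /eqP avE.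
have -> : a ^+ q = (b ^+ q)^-1 ^+ v.
  rewrite -avE -expgM -mulnA [RHS](expg_modl aN (j := q)) //.
  by rewrite -modnMmr vv modnMmr muln1.
by rewrite expgVn -expgM; apply/commute_sym/commuteV/commuteX.
Qed.

(** The element [a ^+ q] commutes with [a] and [b], hence with [c], although [c] raises it to the
    power [d]. So [d - 1 = 3 * t] annihilates it, and [t] is prime to 3. *)
Lemma expa_3q : a ^+ (3 * q) = 1.
Proof.
have /cent1P aq_c : c \in 'C[a ^+ q].
  rewrite -cE groupR //; apply/cent1P; first exact: commuteX.
  exact/commute_sym/commute_expa_b.
pose t := (d %/ 9 * 3 + 2)%N.
have dE : d = (3 * t + 1)%N.
  by rewrite {1}(divn_eq d 9) d7 /t (modn_small (isT : (7 < 9)%N)); ring.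
have co_t : coprime t (3 ^ K.+1).
  by rewrite coprimeXr // coprime_sym prime_coprime // /t /dvdn modnMDl.
apply: (expg_coprime_eq1 co_t); last by rewrite -expgM mulnC expgM aN expg1n.
have /eqP : a ^+ (d * q) = a ^+ q by rewrite expgM -ac -conjXg conjgE -aq_c mulKg.
rewrite dE mulnDl mul1n expgD -[X in _ == X]mul1g (inj_eq (mulIg _)).
by rewrite mulnAC expgM => /eqP.
Qed.

(** The factor 2 stands for an inverse, because the cube of [a ^+ q] is trivial. *)
Lemma expb_q : b ^+ q = a ^+ (q * (2 * (m' * d ^ m))).
Proof.
have /eqP := expb_expa_inv; rewrite -eq_invg_mul => /eqP <-.
apply/eqP; rewrite eq_invg_mul -expgD -mulnDr -mulSn mulnA expgM [(q * 3)%N]mulnC.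
by rewrite expa_3q expg1n.
Qed.

(** In [conjXab] for the exponent [q], the left side is [a ^+ q] by centrality, and so is the power
    of [a] on the right because [geom e q = q] modulo [3 * q]. *)
Lemma expc_q : c ^+ q = 1.
Proof.
have [y gqE] := @geom_3adic e r.+1 q (mod9_mod3 e4) (dvdnn _).
have := conjXab cE ac aN de1 q.
rewrite conjgE commute_expa_b mulKg gqE expgD expgM [(3 ^ r.+2)%N]expnS.
by rewrite expa_3q expg1n mulg1 -{1}[a ^+ q]mulg1 => /mulgI.
Qed.

End PowerRelation.

(** * Normal forms [a ^+ i * b ^+ j * c ^+ k] and the order of the group *)

Section MacdonaldOrder.

Variables (gT : finGroupType) (a b c : gT) (d e r w : nat).
Hypotheses (cE : [~ a, b] = c) (ac : a ^ c = a ^+ d) (bc : b ^ c^-1 = b ^+ d).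
Hypotheses (d7 : (d = 7 %[mod 9])%N) (de1 : (d * e = 1 %[mod 3 ^ r.+2])%N).
Hypothesis aN : a ^+ (3 ^ r.+2) = 1.
Hypotheses (bqE : b ^+ (3 ^ r.+1) = a ^+ (3 ^ r.+1 * w)) (cq : c ^+ (3 ^ r.+1) = 1).

Lemma mod3_inverse : (e = 1 %[mod 3])%N.
Proof.
have d1 : (d = 1 %[mod 3])%N by rewrite -(@modn_dvdm 9 d 3) // d7.
have : (d * e = 1 %[mod 3])%N.
  by rewrite -(@modn_dvdm (3 ^ r.+2) (d * e) 3) ?de1 ?modn_dvdm // expnS dvdn_mulr.
by rewrite -modnMml d1 modnMml mul1n.
Qed.

Lemma b_expN : b ^+ (3 ^ r.+2) = 1.
Proof. by rewrite expnSr expgM bqE -expgM mulnAC expgM -expnSr aN expg1n. Qed.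

Lemma conjb_c n k : c ^+ k * b ^+ n = b ^+ (d ^ k * n) * c ^+ k.
Proof. by rewrite -(conjb_expVc bc) conjgE invgK !mulgA mulgKV. Qed.

Lemma conja_c n k : c ^+ k * a ^+ n = a ^+ (e ^ k * n) * c ^+ k.
Proof.
elim: k n => [|k IHk] n; first by rewrite !mul1g mul1n mulg1.
rewrite expgSr -mulgA.
have -> : c * a ^+ n = a ^+ (e * n) * c.
  by rewrite -(conjVa ac aN de1) conjgE invgK !mulgA mulgKV.
by rewrite mulgA IHk -!mulgA -expgSr expnSr mulnA.
Qed.

(** From [conjXab], [b * a ^+ geom e n = a ^+ n * b * c ^- n]. Replacing [geom e n] by [n] leaves an
    error exponent divisible by one more factor 3, so the induction is on the missing powers of
    3. *)
Lemma b_expa n : exists i k, b * a ^+ n = a ^+ i * b * c ^+ k.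
Proof.
have [t] : exists t, (3 ^ (r.+2 - t) %| n)%N by exists r.+2; rewrite subnn dvd1n.
elim: t n => [|t IHt] n.
  rewrite subn0 => /dvdnP[m ->]; exists 0, 0.
  by rewrite mulnC expgM aN expg1n !mulg1 mul1g.
have [le_t|lt_t] := leqP r.+2 t.
  by move=> _; apply: IHt; move: le_t; rewrite -subn_eq0 => /eqP->; apply: dvd1n.
move=> n3; have [y gE] := @geom_3adic e _ n mod3_inverse n3.
rewrite subnSK // in gE; set z := (_ * y)%N in gE.
have z3 : (3 ^ (r.+2 - t) %| z)%N by rewrite dvdn_mulr.
(* Natural exponents that represent [a ^- z] and [c ^- n]. *)
pose z' := (z * (3 ^ r.+2).-1)%N; pose n' := (n * (3 ^ r.+1).-1)%N.
have az' : a ^+ z * a ^+ z' = 1.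
  by rewrite -expgD -mulnS prednK ?expn_gt0 // mulnC expgM aN expg1n.
have cn' : c ^- n = c ^+ n'.
  apply/eqP; rewrite eq_invg_mul; apply/eqP.
  by rewrite -expgD -mulnS prednK ?expn_gt0 // mulnC expgM cq expg1n.
have [i [k bz]] := IHt (e ^ n' * z')%N (dvdn_mull _ (dvdn_mulr _ z3)).
exists (n + i)%N, (k + n')%N.
have ban : b * a ^+ geom e n = a ^+ n * b * c ^- n.
  have := conjXab cE ac aN de1 n.
  by rewrite conjgE => /(canRL (mulKVg b)) ->; rewrite !mulgA mulgK.
have -> : a ^+ n = a ^+ geom e n * a ^+ z' by rewrite gE expgD -mulgA az' mulg1.
by rewrite mulgA ban cn' -mulgA conja_c mulgA -(mulgA _ b) bz !expgD !mulgA.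
Qed.

Definition abc_form (x : gT) := exists i j k, x = a ^+ i * b ^+ j * c ^+ k.

Lemma expb_expa j n : abc_form (b ^+ j * a ^+ n).
Proof.
elim: j n => [|j IHj] n; first by exists n, 0, 0; rewrite mul1g !mulg1.
have [i [k bE]] := b_expa n; have [i' [j' [k' bE']]] := IHj i.
exists i', (j' + d ^ k' * 1)%N, (k' + k)%N.
rewrite expgSr -mulgA bE !mulgA bE' -(mulgA _ _ b) -[b in LHS]expg1.
by rewrite conjb_c !expgD !mulgA.
Qed.

(** In a finite group every element is a product of generators without inverses, and the normal
    forms are stable under right multiplication by [a] and by [b]. *)
Lemma abc_formP x : x \in <<[set a; b]>> -> abc_form x.
Proof.
case/gen_prodgP=> n [s s_ab ->]; elim: n s s_ab => [|n IHn] s s_ab.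
  by exists 0, 0, 0; rewrite big_ord0 !mulg1.
rewrite big_ord_recr /=.
have [i [j [k ->]]] := IHn _ (fun i => s_ab (widen_ord (leqnSn n) i)).
have /set2P[->|->] := s_ab ord_max.
  have [i' [j' [k' bE]]] := expb_expa j (e ^ k * 1).
  exists (i + i')%N, j', (k' + k)%N.
  by rewrite -mulgA -{2}[a]expg1 conja_c mulgA -(mulgA _ (b ^+ j)) bE !expgD !mulgA.
exists i, (j + d ^ k * 1)%N, k.
by rewrite -mulgA -{2}[b]expg1 conjb_c !expgD !mulgA.
Qed.

Local Notation q := (3 ^ r.+1)%N.

Definition abc_word (t : 'I_(3 * q) * 'I_q * 'I_q) : gT :=
  a ^+ t.1.1 * b ^+ t.1.2 * c ^+ t.2.

Let q_gt0 : (0 < q)%N.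
Proof. by rewrite expn_gt0. Qed.

Let q3_gt0 : (0 < 3 * q)%N.
Proof. by rewrite muln_gt0. Qed.

(** Reducing [j] modulo [q] releases a power of [b ^+ q], which the exponent of [a] absorbs. *)
Definition abc_index i j k : 'I_(3 * q) * 'I_q * 'I_q :=
  (Ordinal (ltn_pmod (i + q * w * (j %/ q)) q3_gt0), Ordinal (ltn_pmod j q_gt0),
   Ordinal (ltn_pmod k q_gt0)).

Lemma abc_wordE i j k : a ^+ i * b ^+ j * c ^+ k = abc_word (abc_index i j k).
Proof.
rewrite /abc_word /= expg_mod -?expnS // [c ^+ (k %% q)]expg_mod //.
congr (_ * _); rewrite expgD -mulgA; congr (_ * _).
by rewrite {1}(divn_eq j q) expgD mulnC expgM bqE -expgM.
Qed.

Lemma abc_word_cover : <<[set a; b]>> \subset abc_word @: setT.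
Proof.
apply/subsetP => x /abc_formP[i [j [k ->]]]; apply/imsetP.
by exists (abc_index i j k); rewrite ?abc_wordE.
Qed.

Lemma leq_card_abc : (#|<<[set a; b]>>| <= 3 * q * q * q)%N.
Proof.
apply: leq_trans (subset_leq_card abc_word_cover) (leq_trans (leq_imset_card _ _) _).
by rewrite cardsT !card_prod !card_ord.
Qed.

Hypotheses (co_w : coprime 3 w) (aq : a ^+ q != 1).

Lemma order_a : #[a] = (3 ^ r.+2)%N.
Proof. exact: order_pfactor. Qed.

Lemma order_b : #[b] = (3 ^ r.+2)%N.
Proof.
apply: order_pfactor b_expN _ => //; apply: contraNneq aq; rewrite bqE expgM => aqw.
by apply/eqP; apply: expg_coprime_eq1 co_w _ aqw; rewrite -expgM -expnSr.
Qed.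

(* Otherwise c ^+ (3 ^ r) centralises b, but it raises b to the power
   d ^ 3 ^ r, which is not 1 modulo 3 ^ r.+2. *)
Lemma expc_notin_b : c ^+ (3 ^ r) \notin <[b]>.
Proof.
apply/negP=> /cycleP[n cE'].
apply: (@expn_mod9_neq1 d r d7); apply/eqP; rewrite -order_b -eq_expg_mod_order.
have := conjb_c 1 (3 ^ r); rewrite cE' -expgD addnC expgD muln1 => /mulIg->.
exact: eqxx.
Qed.

Lemma order_c : #[c] = q.
Proof.
apply: order_pfactor cq _ => //.
by apply: contraNneq expc_notin_b => ->; apply: group1.
Qed.

Lemma norm_cycle_bc : <[c]> \subset 'N(<[b]>).
Proof.
rewrite cycle_subG -groupV; apply/normP/eqP.
by rewrite eqEcard cardJg leqnn andbT -cycleJ bc cycle_subG mem_cycle.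
Qed.

Lemma card_joing_bc : #|<[b]> <*> <[c]>| = (3 * q * q)%N.
Proof.
rewrite norm_joinEr ?norm_cycle_bc //; have := mul_cardG <[b]> <[c]>.
have := @card_cycleI_dvd _ c <[b]> 0 r; rewrite addn0 order_c => /(_ erefl expc_notin_b).
rewrite expn0 dvdn1 setIC => /eqP->; rewrite muln1 => <-.
by rewrite -!orderE order_b order_c -expnS.
Qed.

(* Conjugating b by [a ^+ n = b ^+ j * c ^+ k], where n = 3 ^ r, shows that
   c ^+ n is a power of b. *)
Lemma expa_notin_bc : a ^+ (3 ^ r) \notin <[b]> <*> <[c]>.
Proof.
set n := (3 ^ r)%N; rewrite norm_joinEr ?norm_cycle_bc //.
apply/negP=> /mulsgP[_ _ /cycleP[j ->] /cycleP[k ->] aE].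
have aqE m : a ^+ (q * m) \in <[b]>.
  (* Modulo 3, [w] is its own inverse, so [a ^+ q] equals [b ^+ (q * w)]. *)
  have ww : (w * w = 1 %[mod 3])%N.
    have : ~~ (3 %| w)%N by rewrite -prime_coprime.
    by rewrite /dvdn -modnMm; have := ltn_pmod w (isT : 0 < 3)%N; case: (w %% 3) => [|[|[|]]].
  rewrite expgM groupX // -[a ^+ q]expg1 -(@expg_modl _ _ 3 (w * w) 1) -?expgM -?expnSr //.
  by rewrite mulnA expgM -bqE -expgM mem_cycle.
have [y gE] := @geom_3adic e r n mod3_inverse (dvdnn _).
have e_n : exists y', (e ^ n = 1 + q * y')%N.
  exists (e ^ n %/ q)%N; rewrite {1}(divn_eq (e ^ n) q).
  rewrite (@expn_3adic e r n mod3_inverse (dvdnn _)) modn_small 1?addnC 1?mulnC //.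
  by rewrite -[1%N](expn0 3) ltn_exp2l.
have [y' eE] := e_n.
have cna : c ^+ n * a ^+ n = a ^+ (q * y' * n) * (a ^+ n * c ^+ n).
  by rewrite conja_c eE mulnDl mul1n addnC expgD mulgA.
have ban : a ^+ (q * y) * (a ^+ n * c ^+ n) = b^-1 * b ^+ (d ^ k) * a ^+ n.
  rewrite mulgA -expgD addnC -gE -(conjXab cE ac aN de1) conjgE aE.
  have cb : c ^+ k * b = b ^+ (d ^ k) * c ^+ k by have := conjb_c 1 k; rewrite muln1.
  by rewrite -!mulgA cb; congr (_ * _); rewrite !mulgA -!expgD addnC.
have cnE : c ^+ n = a ^+ (q * y' * n) * a ^- (q * y) * (b^-1 * b ^+ (d ^ k)).
  by apply: (mulIg (a ^+ n)); rewrite cna -[RHS]mulgA -ban !mulgA mulgKV.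
case/negP: expc_notin_b; rewrite -/n cnE !groupM ?groupV ?mem_cycle ?cycle_id //.
by rewrite -mulnA.
Qed.

(** For the lower bound, [<[a]>] has order [3 * q], the subgroup [T] has order [3 * q * q], and
    [expa_notin_bc] bounds their intersection by 3. *)
Lemma card_abc : #|<<[set a; b]>>| = (3 * q * q * q)%N.
Proof.
apply/eqP; rewrite eqn_leq leq_card_abc.
pose P := <<[set a; b]>>%G; pose T := (<[b]> <*> <[c]>)%G.
have aP : a \in P by rewrite mem_gen ?set21.
have bP : b \in P by rewrite mem_gen ?set22.
have cP : c \in P by rewrite -cE groupR.
have sTP : T \subset P by rewrite join_subG !cycle_subG bP.
have := @card_cycleI_dvd _ a T 1 r; rewrite addn1.
move=> /(_ order_a expa_notin_bc)/dvdn_leq-/(_ isT) leI.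
have := mul_cardG <[a]> T; rewrite -orderE order_a card_joing_bc => cardE.
have leP : (#|(<[a]> * T)%g| <= #|P|)%N.
  by apply: subset_leq_card; rewrite mul_subG ?cycle_subG.
rewrite -(leq_pmul2r (isT : (0 < 3)%N)).
apply: leq_trans (leq_mul leP leI); rewrite -cardE [(3 ^ r.+2)%N]expnS.
by apply: eq_leq; ring.
Qed.

Lemma abc_word_inj : injective abc_word.
Proof.
suff /imset_injP inj : #|abc_word @: setT| == #|[set: ('I_(3 * q) * 'I_q * 'I_q)%type]|.
  by move=> s t; apply: inj; rewrite inE.
rewrite eqn_leq leq_imset_card cardsT !card_prod !card_ord -card_abc.
exact: subset_leq_card abc_word_cover.
Qed.

Lemma abc_form_inj i j k i' j' k' :
    a ^+ i * b ^+ j * c ^+ k = a ^+ i' * b ^+ j' * c ^+ k' ->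
  [/\ (i + q * w * (j %/ q) = i' + q * w * (j' %/ q) %[mod 3 * q])%N,
      (j = j' %[mod q])%N & (k = k' %[mod q])%N].
Proof. by rewrite !abc_wordE => /abc_word_inj[]. Qed.

End MacdonaldOrder.

(** * Permutation models *)

Section MonomialMaps.

Import GRing.Theory.

Variables m n : nat.
Local Notation M := m.+2.
Local Notation T := ('I_n.+1 * 'I_M)%type.

(* The i-th entry (u, e, f) of a list sends (i, j) to (u, e * j + f). *)
Definition mono_act (s : seq (nat * nat * nat)) (x : T) : T :=
  let: (u, e, f) := nth (0, 0, 0) s x.1 in
  (inord u, (e%:R * x.2 + f%:R)%R).

Definition mono_wf (s : seq (nat * nat * nat)) : bool :=
  (size s == n.+1) && all (fun t => t.1.1 < n.+1)%N s.

(** The list [s] acts first, as in products of permutations. Coefficients are reduced so that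
    products can be compared as lists. *)
Definition mono_comp (s t : seq (nat * nat * nat)) : seq (nat * nat * nat) :=
  [seq let: (u, e, f) := v in let: (u', e', f') := nth (0, 0, 0) t u in
     (u', e' * e %% M, (e' * f + f') %% M)%N | v <- s].

Definition mono_id : seq (nat * nat * nat) := [seq (i, 1%N, 0) | i <- iota 0 n.+1].

Definition mono_iter s k := iter k (mono_comp s) mono_id.

(* Splitting the exponent only shortens the computations below. *)
Definition mono_exp s k :=
  mono_comp (mono_iter (mono_iter s 9) (k %/ 9)) (mono_iter s (k %% 9)).

Lemma mono_id_wf : mono_wf mono_id.
Proof.
rewrite /mono_wf size_map size_iota eqxx; apply/allP=> _ /mapP[i + ->] /=.
by rewrite mem_iota.
Qed.

Lemma mono_comp_wf s t : mono_wf s -> mono_wf t -> mono_wf (mono_comp s t).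
Proof.
case/andP=> /eqP ss /allP us /andP[/eqP st /allP ut].
rewrite /mono_wf size_map ss eqxx; apply/allP=> _ /mapP[[[u e] f] v_s ->] /=.
case E: (nth _ t u) => [[u' e'] f'] /=.
have := ut (nth (0, 0, 0) t u); rewrite E; apply.
by rewrite -E mem_nth // st (us _ v_s).
Qed.

Lemma mono_act_id x : mono_act mono_id x = x.
Proof.
case: x => i j; rewrite /mono_act (nth_map 0) ?size_iota // nth_iota //= add0n inord_val.
by rewrite mul1r addr0.
Qed.

Lemma mono_act_comp s t x : mono_wf s ->
  mono_act t (mono_act s x) = mono_act (mono_comp s t) x.
Proof.
case/andP=> /eqP ss /allP us; case: x => i j; rewrite /mono_act /=.
rewrite (nth_map (0, 0, 0)) ?ss //.
have := us _ (mem_nth (0, 0, 0) (_ : i < size s)%N); rewrite ss => /(_ (ltn_ord i)).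
case: (nth _ s i) => [[u e] f] /= lt_u; rewrite inordK //.
case: (nth _ t u) => [[u' e'] f'] /=; congr (_, _).
by rewrite !(@Zp_nat_mod M) // !natrD !natrM mulrDr mulrA addrA.
Qed.

Definition is_mono (g : {perm T}) s := mono_wf s /\ g =1 mono_act s.

Lemma is_mono1 : is_mono 1 mono_id.
Proof. by split=> [|x]; rewrite ?mono_id_wf // perm1 mono_act_id. Qed.

Lemma is_monoM g h s t : is_mono g s -> is_mono h t -> is_mono (g * h) (mono_comp s t).
Proof.
move=> [ws gE] [wt hE]; split=> [|x]; first exact: mono_comp_wf.
by rewrite permM hE gE mono_act_comp.
Qed.

Lemma is_mono_iter g s k : is_mono g s -> is_mono (g ^+ k) (mono_iter s k).
Proof.
move=> gs; elim: k => [|k IHk]; first exact: is_mono1.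
by rewrite expgS; apply: is_monoM.
Qed.

Lemma is_monoX g s k : is_mono g s -> is_mono (g ^+ k) (mono_exp s k).
Proof.
move=> gs; rewrite {1}(divn_eq k 9) expgD mulnC expgM.
by apply: is_monoM; do !apply: is_mono_iter.
Qed.

Lemma is_mono_eq g h s t : is_mono g s -> is_mono h t -> s = t -> g = h.
Proof. by move=> [_ gE] [_ hE] st; apply/permP=> x; rewrite gE hE st. Qed.

(** The constant term of the first entry is the second coordinate of the image of (0, 0). *)
Lemma is_mono_neq1 g s : is_mono g s -> ~~ (M %| (nth (0, 0, 0) s 0).2)%N -> g != 1.
Proof.
move=> [_ gE]; apply: contraNneq => g1; have := gE (ord0, 0%R).
rewrite g1 perm1 /mono_act /=; case: (nth _ s 0) => [[u e] f] /= [_].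
by rewrite muln0 mod0n add0n (@val_Zp_nat M) // modn_mod /dvdn => <-.
Qed.

(** The power [k] of the list undoes its action, so the map is injective on a finite set and is a
    permutation. *)
Lemma is_mono_exists s k : mono_wf s -> mono_comp s (mono_exp s k) = mono_id ->
  exists2 g, is_mono g s & g ^+ k.+1 = 1.
Proof.
move=> ws sk; have inj_s : injective (mono_act s).
  apply: (can_inj (g := mono_act (mono_exp s k))) => x.
  by rewrite mono_act_comp // sk mono_act_id.
have gs : is_mono (perm inj_s) s by split=> // x; rewrite permE.
exists (perm inj_s) => //; rewrite expgS.
exact: is_mono_eq (is_monoM gs (is_monoX k gs)) is_mono1 sk.
Qed.

End MonomialMaps.

Definition pow_mod (M e n : nat) : nat := iter n (fun x => (e * x) %% M)%N 1%N.

(* The pair (j, i) stands for the coset of <c> containing b ^+ j * a ^+ i; since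
   a ^+ q = b ^+ (k * q), only the pairs with i < q are kept. *)
Definition model_entry (q k i e f : nat) : nat * nat * nat :=
  (i %% q, e, (f + k * q * (i %/ q)) %% (3 * q))%N.

Definition model_a q k := [seq model_entry q k i.+1 1 0 | i <- iota 0 q].

Definition model_b q k d e :=
  [seq let ei := pow_mod (3 * q) e i in
       model_entry q k ((d * geom_mod (3 * q) d i) %% (3 * q))%N ei ei
  | i <- iota 0 q].

(** This serves for [c] and, with other mutually inverse multipliers, for the element [Z] of the
    model of W. *)
Definition model_diag q k d e := [seq model_entry q k (d * i)%N e 0 | i <- iota 0 q].

(** The last three tests are the relations freed of inverses: [a * b = b * a * c],
    [a * c = c * a ^+ d] and [c * b = b ^+ d * c]. *)
Definition model_check q k d e : bool :=
  let M := (3 * q).-2 in let n := q.-1 in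
  let A := model_a q k in let B := model_b q k d e in let C := model_diag q k d e in
  [&& [&& mono_wf n A, mono_wf n B, mono_wf n C
        & ~~ (M.+2 %| (nth (0, 0, 0) (mono_exp M n A q) 0).2)%N],
      [&& mono_comp M A (mono_exp M n A (3 * q).-1) == mono_id n,
          mono_comp M B (mono_exp M n B (3 * q).-1) == mono_id n
        & mono_comp M C (mono_exp M n C (3 * q).-1) == mono_id n],
      mono_comp M A B == mono_comp M (mono_comp M B A) C,
      mono_comp M A C == mono_comp M C (mono_exp M n A d)
    & mono_comp M C B == mono_comp M (mono_exp M n B d) C].

Lemma conjg_eq (gT : groupType) (x y z : gT) : x * z = z * y -> x ^ z = y.
Proof. by move=> xz; rewrite conjgE xz mulKg. Qed.

Lemma model_checkP q k d e : (0 < q)%N -> model_check q k d e ->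
  exists a b c : {perm 'I_q.-1.+1 * 'I_(3 * q).-2.+2},
  [/\ is_mono a (model_a q k), is_mono c (model_diag q k d e),
      [~ a, b] = c & [/\ a ^ c = a ^+ d, b ^ c^-1 = b ^+ d, is_mono b (model_b q k d e),
      a ^+ (3 * q) = 1 /\ b ^+ (3 * q) = 1 & a ^+ q != 1]].
Proof.
move=> q_gt0; have q3E : (3 * q).-1.+1 = (3 * q)%N by rewrite prednK ?muln_gt0.
set M := (3 * q).-2; set n := q.-1.
case/and5P=> /and4P[wa wb wc aq] /and3P[/eqP a1 /eqP b1 /eqP c1] /eqP ab /eqP ac /eqP cb.
have [a as_] := is_mono_exists wa a1; have [b bs] := is_mono_exists wb b1.
have [c cs _] := is_mono_exists wc c1; rewrite q3E => b3q a3q.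
exists a, b, c; split=> //; last split=> //; last exact: is_mono_neq1 (is_monoX q as_) aq.
- apply: (mulgI (b * a)); rewrite commgEl conjgE !mulgA mulgK mulgV mul1g.
  by apply: is_mono_eq ab; do !apply: is_monoM.
- apply: conjg_eq; apply: is_mono_eq ac; first exact: is_monoM.
  by apply: is_monoM => //; apply: is_monoX.
- rewrite conjgE invgK; apply: (mulIg c); rewrite !mulgA mulgKV.
  apply: is_mono_eq cb; first exact: is_monoM.
  by apply: is_monoM => //; apply: is_monoX.
Qed.

(** By the universal property of G, this model shows that the 27th power of the 3-part of [A] is
    nontrivial. The parameter 2 of the model encodes [a ^+ 27 = b ^+ 54]. *)
Lemma relG_model d : (d = 7 %[mod 9])%N ->
  exists (gT : finGroupType) (a b : gT),
  [/\ a ^ [~ a, b] = a ^+ d, b ^ [~ a, b]^-1 = b ^+ d,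
      a ^+ 81 = 1, b ^+ 81 = 1 & a ^+ 27 != 1].
Proof.
move=> d7.
(* By Euler's theorem the 53rd power is an inverse modulo 81. *)
have chk : all (fun i => let d' := (i * 9 + 7)%N in
    model_check 27 2 d' (pow_mod 81 d' 53)) (iota 0 (81 %/ 9)) by vm_compute.
have := allP chk _ (@modn_div_iota 81 9 d isT isT).
have dE := @modn_modE 81 9 d 7 isT isT d7; rewrite /= -dE.
case/(model_checkP (q := 27) isT) => a [b [c [am _ cE [ac bc _ [a81 b81] a27]]]].
exists {perm 'I_27.-1.+1 * 'I_(3 * 27).-2.+2}, a, b; rewrite cE; split.
- by rewrite ac; apply: (expg_modl a81); rewrite modn_mod.
- by rewrite bc; apply: (expg_modl b81); rewrite modn_mod.
- exact: a81.
- exact: b81.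
exact: a27.
Qed.

Lemma expn_mod9 a n : coprime a 9 -> (a ^ n = (a %% 9) ^ (n %% 6) %[mod 9])%N.
Proof.
move=> co_a; rewrite modnXm {1}(divn_eq n 6) expnD mulnC [(n %/ 6 * 6)%N]mulnC expnM.
have a6 : (a ^ 6 = 1 %[mod 9])%N by apply: (@Euler_exp_totient a 9).
by rewrite -modnMmr -modnXm a6 modnXm exp1n muln1.
Qed.

(** The fifth power of [al] is its inverse modulo 9 when [al] is prime to 3. As [Z ^+ 6 = 1], the
    exponents below 6 suffice. *)
Definition relW_check al : bool :=
  let A := model_a 3 1 in let B := model_b 3 1 7 4 in let C := model_diag 3 1 7 4 in
  let Z := model_diag 3 1 al (pow_mod 9 al 5) in
  [&& mono_wf 2 Z, mono_comp 7 Z (mono_exp 7 2 Z 5) == mono_id 2,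
      mono_comp 7 A Z == mono_comp 7 Z (mono_exp 7 2 A al),
      mono_comp 7 Z B == mono_comp 7 (mono_exp 7 2 B al) Z
    & all (fun g => (al ^ g %% 9 == 7)%N ==> (mono_exp 7 2 Z g == C)) (iota 0 6)].

Lemma relW_model (alpha gamma : nat) :
    (alpha = 2 %[mod 3])%N -> (alpha ^ gamma = 7 %[mod 9])%N ->
  exists (gT : finGroupType) (x y z : gT),
  [/\ x ^ z = x ^+ alpha, y ^ z^-1 = y ^+ alpha, z ^+ gamma = [~ x, y],
      x ^+ 9 = 1 /\ y ^+ 9 = 1 & x ^+ 3 != 1].
Proof.
move=> al2 alg; have co_al : coprime alpha 9.
  rewrite -[9%N]/(3 ^ 2)%N coprimeXr // coprime_sym prime_coprime //.
  by rewrite /dvdn al2.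
have chk : all (fun i => relW_check (i * 3 + 2)) (iota 0 (9 %/ 3)) by vm_compute.
have alE := @modn_modE 9 3 alpha 2 isT isT al2.
have := allP chk _ (@modn_div_iota 9 3 alpha isT isT); rewrite -alE.
set al := (alpha %% 9)%N; case/and5P; set Z := model_diag _ _ _ _.
move=> wZ /eqP zV /eqP az /eqP bz /allP zg.
have chkm : model_check 3 1 7 4 by vm_compute.
have [a [b [c [am cm cE [ac bc bm [a9 b9] a3]]]]] := @model_checkP 3 1 7 4 isT chkm.
have [z zm z6] := is_mono_exists wZ zV.
exists {perm 'I_3.-1.+1 * 'I_(3 * 3).-2.+2}, a, b, z; split.
- rewrite -(expg_mod alpha a9); apply: conjg_eq; apply: is_mono_eq az.
    exact: is_monoM am zm.
  exact: is_monoM zm (is_monoX al am).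
- rewrite -(expg_mod alpha b9) conjgE invgK; apply: (mulIg z); rewrite !mulgA mulgKV.
  apply: is_mono_eq bz; first exact: is_monoM zm bm.
  exact: is_monoM (is_monoX al bm) zm.
- rewrite cE -(expg_mod gamma z6); apply: is_mono_eq (is_monoX _ zm) cm _.
  have g6 : (gamma %% 6)%N \in iota 0 6 by rewrite mem_iota ltn_mod.
  have := implyP (zg _ g6); rewrite -(expn_mod9 _ co_al) alg => /(_ isT)/eqP.
  exact.
- by split; [apply: a9 | apply: b9].
exact: a3.
Qed.

Lemma expgz_modn (gT : groupType) (x : gT) (z : int) (k N : nat) : x ^+ N = 1 ->
  (z = k%:Z %[mod N])%Z -> expgz x z = x ^+ k.
Proof.
case: N => [|N] xN.
  by rewrite !modz0 => ->.
case: z => n nk; rewrite /expgz.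
  by apply: (expg_modl xN); move: nk; rewrite !modz_nat => -[].
apply/eqP; rewrite eq_sym -[_ == _](inj_eq (mulIg (x ^+ n.+1))) mulVg -expgD; apply/eqP.
rewrite -[RHS](expg0 x); apply: (expg_modl xN); rewrite mod0n; apply/eqP.
move/eqP: nk; rewrite eqz_mod_dvd NegzE -GRing.opprD dvdzE abszN.
by rewrite -PoszD addnC.
Qed.

(** * Sylow projections and presentations *)

Section PartialMorphism.

Variables (gT : finGroupType) (G : {group gT}) (H : groupType) (h : gT -> H).
Hypothesis hM : {in G &, {morph h : u v / u * v}}.

Lemma pmorph1 : h 1 = 1.
Proof. by apply: (mulgI (h 1)); rewrite -hM ?group1 // !mulg1. Qed.

Lemma pmorphX x n : x \in G -> h (x ^+ n) = h x ^+ n.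
Proof.
move=> Gx; elim: n => [|n IHn]; first exact: pmorph1.
by rewrite !expgS hM ?groupX // IHn.
Qed.

Lemma pmorphV x : x \in G -> h x^-1 = (h x)^-1.
Proof. by move=> Gx; apply: (mulgI (h x)); rewrite -hM ?groupV // !mulgV pmorph1. Qed.

Lemma pmorphR x y : x \in G -> y \in G -> h [~ x, y] = [~ h x, h y].
Proof. by move=> Gx Gy; rewrite !commgEl !conjgE !hM ?pmorphV ?groupM ?groupV. Qed.

Definition pker := [set x in G | h x == 1].

Lemma pker_group_set : group_set pker.
Proof.
apply/group_setP; split=> [|x y]; first by rewrite inE group1 pmorph1 /=.
rewrite !inE => /andP[Gx /eqP hx] /andP[Gy /eqP hy].
by rewrite groupM //= hM // hx hy mulg1.
Qed.
Canonical pker_group := Group pker_group_set.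

End PartialMorphism.

Section SylowProjection.

Variables (gT : finGroupType) (G : {group gT}) (p : nat).
Hypothesis nilG : nilpotent G.

Lemma pcore_dprod : 'O_p(G) \x 'O_p^'(G) = G.
Proof. exact: nilpotent_pcoreC. Qed.

Lemma constt_pcore x : x \in G -> (x.`_p \in 'O_p(G)) && (x.`_p^' \in 'O_p^'(G)).
Proof.
move=> Gx; have Gc pi : x.`_pi \in G by rewrite groupX.
rewrite !(mem_normal_Hall (nilpotent_pcore_Hall _ _) (pcore_normal _ _)) // !p_elt_constt //.
Qed.

(** The two constituents of [x] are its factors in the direct product. In this form the projection
    is visibly a power of [x] and commutes with morphisms. *)
Lemma sylow_proj_constt x : x \in G -> sylow_proj p G x = x.`_p.
Proof.
move=> Gx; have /andP[x1 x2] := constt_pcore Gx; have [_ _ _ tiO] := dprodP pcore_dprod.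
by rewrite /sylow_proj -{1}(consttC p x) divgrMid.
Qed.

(** The 3-part case is the one used; for any [p], p-parts and p'-parts of elements of a nilpotent
    group commute, so a product can be regrouped. *)
Lemma consttM_nil : {in G &, {morph (fun x => x.`_p) : x y / x * y}}.
Proof.
move=> x y Gx Gy /=; have [_ _ cO _] := dprodP pcore_dprod.
have /andP[x1 x2] := constt_pcore Gx; have /andP[y1 y2] := constt_pcore Gy.
rewrite -{1}(consttC p x) -{1}(consttC p y).
have x2y1 : commute x.`_p^' y.`_p by apply: (centsP cO).
rewrite -mulgA (mulgA _ y.`_p) x2y1 -!mulgA (mulgA x.`_p) consttM; last first.
  by apply/commute_sym/(centsP cO); rewrite groupM.
rewrite constt_p_elt ?(mem_p_elt (pcore_pgroup _ _) (groupM x1 y1)) //.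
have /constt1P-> : (p^').-elt (x.`_p^' * y.`_p^').
  by rewrite (mem_p_elt (pcore_pgroup _ _) (groupM x2 y2)).
by rewrite mulg1.
Qed.

Canonical constt_morphism := Morphism consttM_nil.

End SylowProjection.

Lemma inverse7_mod9 d e : (d = 7 %[mod 9])%N -> (d * e = 1 %[mod 9])%N ->
  (e = 4 %[mod 9])%N.
Proof. by move=> d7; rewrite -modnMml d7; lia. Qed.

(** * The cases [q = 27] and [q = 3] *)

Section MacdonaldSylow.

Variables (gT : finGroupType) (a b c : gT) (d e K : nat).
Hypotheses (cE : [~ a, b] = c) (ac : a ^ c = a ^+ d) (bc : b ^ c^-1 = b ^+ d).
Hypotheses (K3 : (2 < K)%N) (aN : a ^+ (3 ^ K.+1) = 1) (bN : b ^+ (3 ^ K.+1) = 1).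
Hypotheses (d7 : (d = 7 %[mod 9])%N) (de1 : (d * e = 1 %[mod 3 ^ K.+1])%N).

Lemma inverse_dvd k : (k <= K.+1)%N -> (d * e = 1 %[mod 3 ^ k])%N.
Proof.
move=> le_k; rewrite -(@modn_dvdm (3 ^ K.+1) (d * e)) ?dvdn_exp2l // de1.
by rewrite modn_dvdm // dvdn_exp2l.
Qed.

Lemma inverse_mod9 : (e = 4 %[mod 9])%N.
Proof. exact: inverse7_mod9 d7 (@inverse_dvd 2 (leqW (ltnW K3))). Qed.

Lemma macdonald_27 :
  exists w, [/\ coprime 3 w, a ^+ 81 = 1,
    b ^+ 27 = a ^+ (27 * w) & c ^+ 27 = 1].
Proof.
(* The bound [2 < K] makes 81 divide [3 ^ K.+1]. *)
have e4 := inverse_mod9; have de81 := @inverse_dvd 4 K3.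
have [n n_de [u gE co_u]] := geom_sub_27 d7 e4 de81.
have [z [n' [az bz cz nn]]] : exists z n', [/\ a ^ z = a ^+ n, b ^ z^-1 = b ^+ n,
    c ^ z = c & (n * n' = 1 %[mod 3 ^ K.+1])%N].
  case: n_de => ->.
    by exists c, e; split; rewrite // conjgE mulKg.
  exists c^-1, d; split; last by rewrite mulnC.
  - by rewrite -[a in LHS]expg1 (conjVa ac aN de1) muln1.
  - by rewrite invgK -[b in LHS]expg1 (conjb bc bN de1) muln1.
  by rewrite conjgE invgK mulgA mulgK.
exists (2 * (n' * d ^ n))%N; rewrite coprimeMr (coprime_m'd d7 nn) /=; split=> //.
- exact: (expa_3q cE ac bc d7 aN bN de1 nn az bz cz (r := 2) gE co_u).
- exact: (expb_q cE ac bc d7 aN bN de1 nn az bz cz (r := 2) gE co_u).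
exact: (expc_q cE ac bc d7 e4 aN bN de1 nn az bz cz (r := 2) gE co_u).
Qed.

Lemma macdonald_3 (z : gT) (m m' : nat) : (m = 2 %[mod 3])%N ->
    (m * m' = 1 %[mod 3 ^ K.+1])%N ->
    a ^ z = a ^+ m -> b ^ z^-1 = b ^+ m -> c ^ z = c ->
  [/\ a ^+ 9 = 1, b ^+ 3 = a ^+ 3 & c ^+ 3 = 1].
Proof.
move=> m2 mm az bz cz; have e4 := inverse_mod9.
have [u gE co_u] := geom_sub_3 e4 m2.
have a9 := expa_3q cE ac bc d7 aN bN de1 mm az bz cz (r := 0) gE co_u.
split; first exact: a9.
- have := expb_q cE ac bc d7 aN bN de1 mm az bz cz (r := 0) gE co_u.
  rewrite expn1 => ->; apply: (expg_modl a9).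
  (* Modulo 3 the exponent [2 * (m' * d ^ m)] is 2 times 2 times 1, that is 1. *)
  have m'2 : (m' = 2 %[mod 3])%N.
    have : (m * m' = 1 %[mod 3])%N.
      by rewrite -(@modn_dvdm (3 ^ K.+1) (m * m') 3) ?mm ?modn_dvdm ?expnS ?dvdn_mulr.
    by rewrite -modnMml m2; lia.
  have dm1 : (d ^ m = 1 %[mod 3])%N.
    by apply: expn_mod3; rewrite -(@modn_dvdm 9 d 3) // d7.
  have w1 : (2 * (m' * d ^ m) = 1 %[mod 3])%N.
    by rewrite -modnMmr -(modnMm m') m'2 dm1.
  by rewrite -muln_modr w1.
exact: (expc_q cE ac bc d7 e4 aN bN de1 mm az bz cz (r := 0) gE co_u).
Qed.

Lemma card_macdonald_3 : a ^+ 9 = 1 -> b ^+ 3 = a ^+ 3 -> c ^+ 3 = 1 -> a ^+ 3 != 1 ->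
  #|<<[set a; b]>>| = 81.
Proof.
move=> a9 b3 c3 a3; have b3' : b ^+ 3 = a ^+ (3 * 1) by rewrite muln1.
have de9 := @inverse_dvd 2 (leqW (ltnW K3)).
exact: (card_abc cE ac bc d7 de9 (r := 0) a9 b3' c3 isT a3).
Qed.

Hypothesis a27 : a ^+ 27 != 1.

Lemma order_macdonald_27 : #[a] = 81.
Proof. by have [_ [_ a81 _ _]] := macdonald_27; apply: (@order_pfactor _ a 3 3). Qed.

Lemma order_macdonald_27b : #[b] = 81.
Proof.
have [w [co_w a81 b27 c27]] := macdonald_27.
exact: (order_b (r := 2) a81 b27 co_w a27).
Qed.

Lemma card_macdonald_27 : #|<<[set a; b]>>| = (3 ^ 10)%N.
Proof.
have [w [co_w a81 b27 c27]] := macdonald_27.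
rewrite (card_abc cE ac bc d7 (@inverse_dvd 4 K3) (r := 2) a81 b27 c27 co_w a27).
by rewrite -[(3 * _)%N]expnS -!expnD.
Qed.

(** The words [a ^+ (9 * i) * b ^+ (9 * j) * c ^+ (3 * k)] with [i < 9], [j < 3], [k < 9] give
    [3 ^ 5] distinct elements. The generator [a ^+ 3 * b ^- 3] is not among them, since its exponent
    of [b] is not a multiple of 9 modulo 27. *)
Lemma card_macdonald_sub :
  (3 ^ 5 < #|<<[set a ^+ 3 * b ^- 3; a ^+ 9; b ^+ 9; c ^+ 3]>>%g|)%N.
Proof.
have [w [co_w a81 b27 c27]] := macdonald_27.
set S := [set _; _; _; _]; pose M := <<S>>%G.
have inj i j k i' j' k' : a ^+ i * b ^+ j * c ^+ k = a ^+ i' * b ^+ j' * c ^+ k' ->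
    [/\ (i + 27 * w * (j %/ 27) = i' + 27 * w * (j' %/ 27) %[mod 81])%N,
      (j = j' %[mod 27])%N & (k = k' %[mod 27])%N].
  exact: (abc_form_inj cE ac bc d7 (@inverse_dvd 4 K3) (r := 2) a81 b27 c27 co_w a27).
pose g (t : 'I_9 * 'I_3 * 'I_9) := a ^+ (9 * t.1.1) * b ^+ (9 * t.1.2) * c ^+ (3 * t.2).
have [Mab Ma Mb Mc] : [/\ a ^+ 3 * b ^- 3 \in M, a ^+ 9 \in M, b ^+ 9 \in M
    & c ^+ 3 \in M].
  by split; apply: mem_gen; rewrite !inE eqxx ?orbT.
have g_inj : injective g.
  move=> [[i j] k] [[i' j'] k'] /inj /= [].
  have lt_i := ltn_ord i; have lt_j := ltn_ord j; have lt_k := ltn_ord k.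
  have lt_i' := ltn_ord i'; have lt_j' := ltn_ord j'; have lt_k' := ltn_ord k'.
  have j0 n : (n < 3)%N -> (9 * n %/ 27 = 0)%N by move=> n3; rewrite divn_small //; lia.
  rewrite !j0 // muln0 !addn0 => ei ej ek; do ![congr (_, _)]; apply: val_inj => /=.
  - by clear -lt_i lt_i' ei; lia.
  - by clear -lt_j lt_j' ej; lia.
  by clear -lt_k lt_k' ek; lia.
have gM : g @: setT \subset M.
  apply/subsetP=> _ /imsetP[t _ ->]; rewrite /g (expgM a) (expgM b) (expgM c).
  exact: groupM (groupM (groupX _ Ma) (groupX _ Mb)) (groupX _ Mc).
have card_g : #|g @: setT| = (3 ^ 5)%N.
  by rewrite card_imset // cardsT !card_prod !card_ord.
rewrite -card_g -/(gval M); apply: proper_card; rewrite properE gM; apply/subsetPn.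
exists (a ^+ 3 * b ^- 3) => //.
apply/negP=> /imsetP[t _]; rewrite /g.
have -> : b ^- 3 = b ^+ 78.
  apply/eqP; rewrite eq_invg_mul -expgD; apply/eqP.
  by rewrite (expgM b 27 3 : b ^+ (3 + 78) = _) b27 -expgM mulnAC expgM a81 expg1n.
rewrite -[LHS]mulg1 -(expg0 c) => /inj[_ ej _]; clear -ej; lia.
Qed.

End MacdonaldSylow.

(** * Passing between W and the image of G, and the presentation of [W3] *)

Lemma pHall_normal_sub (pi : nat_pred) (gT : finGroupType) (V W Q : {group gT}) :
    V <| W -> pi^'.-nat #|W : V| -> Q <| V -> pi.-Hall(V) Q ->
  Q <| W /\ pi.-Hall(W) Q.
Proof.
move=> nVW pi'W nQV hQ; have QE := normal_Hall_pcore hQ nQV.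
have nQW : Q <| W by rewrite -QE; apply: char_normal_trans (pcore_char _ _) nVW.
have [sQV piQ pi'V] := and3P hQ; split=> //; apply/and3P; split=> //.
  exact: normal_sub.
by rewrite -(Lagrange_index (normal_sub nVW) sQV) pnatM pi'W.
Qed.

(** [Z] normalises [<[X]>] and [<[Y]>], hence their join; the quotient is generated by the image of
    [Z], whose power [g] is trivial. *)
Lemma normal_gen2_gen3 (gT : finGroupType) (X Y Z : gT) m g :
    X ^ Z = X ^+ m -> Y ^ Z^-1 = Y ^+ m -> Z ^+ g = [~ X, Y] ->
  <<[set X; Y]>> <| <<[set X; Y; Z]>> /\ (#|<<[set X; Y; Z]>> : <<[set X; Y]>>| %| g)%N.
Proof.
move=> XZ YZ Zg; pose V := <<[set X; Y]>>%G.
have VX : X \in V by rewrite mem_gen ?set21.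
have VY : Y \in V by rewrite mem_gen ?set22.
have norm_pow (x z : gT) n : x ^ z = x ^+ n -> z \in 'N(<[x]>).
  move=> xz; apply/normP/eqP.
  by rewrite eqEcard cardJg leqnn andbT -cycleJ xz cycle_subG mem_cycle.
have VE : V = (<[X]> <*> <[Y]>)%G by apply: val_inj; rewrite /= joing_idl joing_idr.
have nVZ : Z \in 'N(V).
  rewrite VE -cycle_subG normsY // cycle_subG; first exact: norm_pow XZ.
  by rewrite -groupV; apply: norm_pow YZ.
have WE : <<[set X; Y; Z]>> = V <*> <[Z]> by rewrite /= joing_idl joing_idr.
have nVW : V <| V <*> <[Z]>.
  by rewrite normalYl cycle_subG.
rewrite -/(gval V) WE; split=> //; rewrite -card_quotient ?normal_norm //.
rewrite quotientYidl ?cycle_subG // quotient_cycle // -orderE order_dvdn.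
by rewrite -morphX //= Zg coset_id // groupR.
Qed.

(** A cube prime to 3 is 1 or -1 modulo 9, never 7. *)
Lemma coprime3_exponent m g : (m = 2 %[mod 3])%N -> (m ^ g = 7 %[mod 9])%N ->
  coprime 3 g.
Proof.
move=> m2; have co_m : coprime m 9.
  rewrite -[9%N]/(3 ^ 2)%N coprimeXr // coprime_sym prime_coprime //.
  by rewrite /dvdn m2.
rewrite expn_mod9 // prime_coprime // => mg; apply/negP => g3.
have chk : all (fun i => all (fun j => ((i * 3 + 2) ^ (3 * j) %% 9 != 7)%N) (iota 0 2))
    (iota 0 (9 %/ 3)) by [].
have mE := @modn_modE 9 3 m 2 isT isT m2.
have gE : (g %% 6 = 3 * (g %% 6 %/ 3))%N.
  by rewrite mulnC divnK // /dvdn modn_dvdm.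
have := allP (allP chk _ (@modn_div_iota 9 3 m isT isT)) _ (@modn_div_iota 6 3 g isT isT).
by rewrite -mE -gE mg.
Qed.

(** A group [H] satisfying [relW3] also satisfies [relG], so it receives a map [h] from G. This map
    kills the generators of the kernel of [f] on [P], and therefore factors through [f]. *)
Lemma presented3_relW3 (wT : finGroupType) (W3 : {group wT}) (gT : finGroupType)
    (G P : {group gT}) (A B a b : gT) (x y : wT) (delta : int)
    (f : {morphism G >-> wT}) :
    (delta = 7 %[mod 9])%Z -> presented2 (relG delta) G A B ->
    (exists r, (r = 1 %[mod 9])%N /\ a = A ^+ r) ->
    (exists r, (r = 1 %[mod 9])%N /\ b = B ^+ r) ->
    P \subset G -> a \in P -> b \in P -> f a = x -> f b = y -> W3 :=: f @* P ->
    W3 :=: <<[set x; y; [~ x, y]]>> ->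
    'ker f :&: P = <<[set a ^+ 3 * b ^- 3; a ^+ 9; b ^+ 9; [~ a, b] ^+ 3]>> ->
    relW3 x y [~ x, y] ->
  presented3 relW3 W3 x y [~ x, y].
Proof.
move=> d7 [genG _ univG] [r [r1 aE]] [s [s1 bE]] sPG Pa Pb fa fb W3E W3gen kerE rel3.
split=> // H x' y' z' [ax bx [a9 b9 c3] ab3 abc].
have relGH : relG delta x' y'.
  (* Modulo 9 the exponents -2 and 7 agree, and 4 is inverse to 7. *)
  split; rewrite abc.
    rewrite (expgz_modn (k := 7) a9 d7) ax.
    by apply: (mulgI (x' ^+ 2)); rewrite mulgV -expgD a9.
  rewrite (expgz_modn (k := 7) b9 d7).
  apply: (conjg_inj z'); rewrite conjgKV conjXg bx -expgM -[y' in LHS]expg1.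
  exact: (expg_modl b9).
have [h [hM hA hB]] := univG H x' y' relGH.
have GA : A \in G by rewrite genG mem_gen ?set21.
have GB : B \in G by rewrite genG mem_gen ?set22.
have ha : h a = x'.
  by rewrite aE (pmorphX hM) // hA -[RHS]expg1; apply: (expg_modl a9).
have hb : h b = y'.
  by rewrite bE (pmorphX hM) // hB -[RHS]expg1; apply: (expg_modl b9).
have Ga := subsetP sPG a Pa; have Gb := subsetP sPG b Pb.
have hc : h [~ a, b] = z' by rewrite (pmorphR hM) // ha hb.
have kerh : 'ker f :&: P \subset pker G h.
  rewrite kerE gen_subG; apply/subsetP=> u; rewrite !inE -!orbA => /or4P[] /eqP->.
  - by rewrite groupM ?groupV ?groupX //= hM ?groupV ?groupX // (pmorphV hM) ?groupX //
      !(pmorphX hM) // ha hb ab3 mulgV.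
  - by rewrite groupX //= (pmorphX hM) // ha a9.
  - by rewrite groupX //= (pmorphX hM) // hb b9.
  by rewrite groupX ?groupR //= (pmorphX hM) ?groupR // hc c3.
(* A choice of preimages in [P]; the default 1 is taken only outside [W3]. *)
pose pre w := odflt 1 [pick v in P | f v == w].
have preP w : w \in W3 -> pre w \in P /\ f (pre w) = w.
  rewrite W3E => /morphimP[v Gv Pv ->]; rewrite /pre; case: pickP => [u /andP[Pu /eqP] //|].
  by move/(_ v); rewrite Pv eqxx.
have h_eq u v : u \in P -> v \in P -> f u = f v -> h u = h v.
  move=> Pu Pv fuv; have [Gu Gv] := (subsetP sPG u Pu, subsetP sPG v Pv).
  have : u * v^-1 \in 'ker f :&: P.
    rewrite in_setI; apply/andP; split; last by rewrite groupM ?groupV.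
    apply/kerP; first by rewrite groupM ?groupV.
    by rewrite morphM ?groupV // morphV // fuv mulgV.
  move/(subsetP kerh); rewrite inE => /andP[_ /eqP]; rewrite hM ?groupV //.
  rewrite (pmorphV hM) // => huv.
  by apply: (mulIg (h v)^-1); rewrite huv mulgV.
have h_pre v : v \in P -> h (pre (f v)) = h v.
  move=> Pv; have /preP[Ppre fpre] : f v \in W3 by rewrite W3E mem_morphim // (subsetP sPG).
  exact: h_eq.
exists (h \o pre); split=> /=.
- move=> u v Wu Wv; have [Pu fu] := preP u Wu; have [Pv fv] := preP v Wv.
  have [Gu Gv] := (subsetP sPG _ Pu, subsetP sPG _ Pv).
  rewrite -hM //; have [Puv fuv] := preP (u * v) (groupM Wu Wv).
  by apply: h_eq; rewrite ?groupM // fuv morphM // fu fv.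
- by rewrite -fa h_pre.
- by rewrite -fb h_pre.
by rewrite -fa -fb -morphR // h_pre ?groupR.
Qed.

Lemma modz_dvd_eq (u v : int) (M L : nat) : (M %| L)%N ->
  (u = v %[mod L])%Z -> (u = v %[mod M])%Z.
Proof.
move=> ML /eqP uv; apply/eqP; move: uv; rewrite !eqz_mod_dvd.
by apply: dvdz_trans; rewrite dvdzE.
Qed.

(** Taking p-parts is idempotent, so the exponent that extracts the p-part of [x] fixes that
    p-part. *)
Lemma constt_expg (gT : finGroupType) p (x : gT) : exists2 r,
  (r = 1 %[mod #[x.`_p]])%N & x.`_p = x ^+ r.
Proof.
have /cycleP[r xr] := cycle_constt p x; exists r => //; apply/eqP.
rewrite -eq_expg_mod_order expg1 -consttX -xr.
by rewrite constt_p_elt ?p_elt_constt.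
Qed.

Lemma Syl_normal (p : nat) (gT : finGroupType) (W Q P : {group gT}) :
  Q <| W -> p.-Sylow(W) Q -> p.-Sylow(W) P -> 'Syl_p(W) = [set P] /\ P = Q.
Proof.
move=> nQW sylQ; have QE := normal_Hall_pcore sylQ nQW.
have sylO : p.-Sylow(W) 'O_p(W) by rewrite QE.
have uniqQ (R : {group gT}) : p.-Sylow(W) R -> R = Q.
  by move=> sylR; apply: val_inj; rewrite /= (eq_Hall_pcore sylO sylR) QE.
move=> sylP; split; last exact: uniqQ; rewrite (uniqQ _ sylP).
apply/setP=> R; rewrite !inE; apply/idP/eqP => [/uniqQ //|-> //].
Qed.

(** * Orders, generators and presentation of [G3], [N3] and [W3] *)

Theorem theorem9p2
  (alpha : int) (gamma : nat)
  (gamma_gt0 : (0 < gamma)%N)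
  (alpha_gamma : ((alpha ^+ gamma)%R = 7 %[mod 9])%Z)
  (alpha_mod3 : (alpha = -1 %[mod 3])%Z)
  (wT : finGroupType) (W : {group wT}) (X Y Z : wT)
  (presW : presented3 (relW alpha gamma) W X Y Z)
  (gT : finGroupType) (G : {group gT}) (A B : gT)
  (presG : presented2 (relG (alpha ^+ gamma)%R) G A B)
  (nilG : nilpotent G)
  (f : {morphism G >-> wT}) (fA : f A = X) (fB : f B = Y)
  (G3 : {group gT}) (sylG3 : 3.-Sylow(G) G3)
  (W3 : {group wT}) (sylW3 : 3.-Sylow(W) W3) :
  let N3 := 'ker f :&: G3 in
  let a := sylow_proj 3 G A in
  let b := sylow_proj 3 G B in
  let c := [~ a, b] in
  [/\ N3 = <<[set a ^+ 3 * b ^- 3; a ^+ 9; b ^+ 9; c ^+ 3]>>,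
      #|N3| = (3 ^ 6)%N,
      W3 \isog G3 / N3,
      'Syl_3(W) = [set W3] &
      #|W3| = 81 /\
      exists a0 b0 c0 : wT, presented3 relW3 W3 a0 b0 c0].
Proof.
move=> N3 a b c; have [WE [XZ YZ Zg] univW] := presW.
have [GE [relA relB] univG] := presG.
have GA : A \in G by rewrite GE mem_gen ?set21.
have GB : B \in G by rewrite GE mem_gen ?set22.
(* All exponents in use (those of G, of W and of both models) divide [L], so [alpha] can be replaced
   by a natural number congruent to it modulo [L]. *)
pose L := (#|G| * #|W| * 81)%N.
have [al alE] : exists al : nat, (alpha = al%:Z %[mod L])%Z.
  exists `|(alpha %% L)%Z|%N; rewrite gez0_abs ?modz_mod // modz_ge0 //.
  by rewrite eqz_nat -lt0n /L !muln_gt0 !cardG_gt0.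
pose d := (al ^ gamma)%N; pose delta : int := (alpha ^+ gamma)%R.
have dE : (delta = d%:Z %[mod L])%Z.
  by rewrite /delta /d -modzXm alE modzXm -!natz GRing.natrX.
have al2 : (al = 2 %[mod 3])%N.
  have : (alpha = al%:Z %[mod 3%N])%Z by apply: modz_dvd_eq alE; rewrite dvdn_mull.
  by rewrite alpha_mod3 modz_nat => -[].
have d7 : (d = 7 %[mod 9])%N.
  have : (delta = d%:Z %[mod 9%N])%Z by apply: modz_dvd_eq dE; rewrite dvdn_mull.
  by rewrite /delta alpha_gamma modz_nat => -[].
have expgz_delta (H : groupType) (x : H) n :
    (n %| L)%N -> x ^+ n = 1 -> expgz x delta = x ^+ d.
  by move=> nL xn; apply: expgz_modn xn (modz_dvd_eq nL dE).
have expgz_alpha (H : groupType) (x : H) n :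
    (n %| L)%N -> x ^+ n = 1 -> expgz x alpha = x ^+ al.
  by move=> nL xn; apply: expgz_modn xn (modz_dvd_eq nL alE).
have GL : (#|G| %| L)%N by rewrite /L -mulnA dvdn_mulr.
have WL : (#|W| %| L)%N by rewrite /L mulnAC dvdn_mull.
have L9 : (9 %| L)%N by rewrite dvdn_mull.
have L81 : (81 %| L)%N by rewrite dvdn_mull.
have AE : a = A.`_3 by apply: sylow_proj_constt.
have BE : b = B.`_3 by apply: sylow_proj_constt.
clearbody a b.
pose phi := constt_morphism 3 nilG.
have ac : a ^ c = a ^+ d.
  rewrite /c AE BE -[A.`_3]/(phi A) -[B.`_3]/(phi B) -morphR // -morphJ ?groupR //.
  by rewrite relA (expgz_delta _ _ #|G|) ?expg_cardG // morphX.
have bc : b ^ c^-1 = b ^+ d.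
  rewrite /c AE BE -[A.`_3]/(phi A) -[B.`_3]/(phi B) -morphR // -morphV ?groupR //.
  rewrite -morphJ ?groupV ?groupR // relB (expgz_delta _ _ #|G|) ?expg_cardG //.
  by rewrite morphX.
have G3O : G3 :=: 'O_3(G) := nilpotent_Hall_pcore nilG sylG3.
have G3a : a \in G3 by rewrite AE G3O; case/andP: (constt_pcore 3 nilG GA).
have G3b : b \in G3 by rewrite BE G3O; case/andP: (constt_pcore 3 nilG GB).
have sG3G : G3 \subset G := pHall_sub sylG3.
have pG3 : 3.-group G3 := pHall_pgroup sylG3.
have G3E : G3 :=: <<[set a; b]>>.
  apply/eqP; rewrite eqEsubset gen_subG subUset !sub1set G3a G3b !andbT.
  apply/subsetP=> u G3u; have Gu := subsetP sG3G u G3u.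
  have <- : phi u = u by apply: constt_p_elt (mem_p_elt pG3 G3u).
  have -> : [set a; b] = phi @* [set A; B].
    by rewrite morphimU !morphim_set1 // AE BE.
  by rewrite -morphim_gen -?GE ?mem_morphim // subUset !sub1set GA.
(* Large enough for [3 ^ K.+1] to annihilate [G3] and for [2 < K] to hold. *)
pose K := (logn 3 #|G3| + 3)%N.
have expN u : u \in G3 -> u ^+ (3 ^ K.+1) = 1.
  move=> G3u; apply/eqP; rewrite -order_dvdn (dvdn_trans (order_dvdG G3u)) //.
  by rewrite (card_pgroup pG3) dvdn_exp2l // /K -addnS leq_addr.
have K3 : (2 < K)%N by rewrite /K leq_addl.
have [aN bN] := (expN a G3a, expN b G3b).
have [e de1] : exists e, (d * e = 1 %[mod 3 ^ K.+1])%N.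
  apply: inverse_mod; rewrite coprimeXr // coprime_sym prime_coprime //.
  by rewrite /dvdn -(@modn_dvdm 9 d 3) // d7.
have e4 := inverse_mod9 K3 d7 de1.
have a27 : a ^+ 27 != 1.
  have [hT [pa [pb [pac pbc pa81 pb81 pa27]]]] := relG_model d7.
  have [h [hM hA hB]] := univG hT pa pb
    (conj (etrans pac (esym (expgz_delta _ _ _ L81 pa81)))
          (etrans pbc (esym (expgz_delta _ _ _ L81 pb81)))).
  apply: contraNneq pa27 => a27; pose hm := Morphism hM.
  (* The element [pa] has order dividing 81, so it equals the image of the 3-part of [A]. *)
  have <- : hm a = pa.
    rewrite AE morph_constt //= hA constt_p_elt // /p_elt (pnat_dvd (_ : _ %| 81)%N) //.
    by rewrite order_dvdn pa81.
  by rewrite -morphX ?a27 ?morph1 // (subsetP sG3G).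
have oG3 : #|G3| = (3 ^ 10)%N.
  by rewrite G3E; apply: (card_macdonald_27 (erefl c) ac bc K3 aN bN d7 de1 a27).
have WX : X \in W by rewrite WE mem_gen // !inE eqxx.
have WY : Y \in W by rewrite WE mem_gen // !inE eqxx orbT.
have XZ' : X ^ Z = X ^+ al by rewrite XZ (expgz_alpha _ _ _ WL) ?expg_cardG.
have YZ' : Y ^ Z^-1 = Y ^+ al by rewrite YZ (expgz_alpha _ _ _ WL) ?expg_cardG.
have VE : f @* G = <<[set X; Y]>>.
  have -> : f @* G = f @* <<[set A; B]>> by rewrite -GE.
  by rewrite morphim_gen ?subUset ?sub1set ?GA // morphimU !morphim_set1 // fA fB.
have [nVW VW] := normal_gen2_gen3 XZ' YZ' Zg; rewrite -VE -WE in nVW VW.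
(* The index divides [gamma], which is prime to 3; thus the image of [G3] is already a Sylow
   subgroup of W. *)
have VW3 : 3^'.-nat #|W : f @* G|.
  rewrite p'natE // -prime_coprime //.
  exact: coprime_dvdr VW (coprime3_exponent al2 d7).
have nG3G : G3 <| G by rewrite G3O pcore_normal.
have [nQW sylQ] := pHall_normal_sub nVW VW3 (morphim_normal f nG3G)
  (morphim_pHall f sG3G sylG3).
have [Syl3 W3E] := Syl_normal nQW sylQ sylW3.
pose x := f a; pose y := f b.
have Ga := subsetP sG3G a G3a; have Gb := subsetP sG3G b G3b.
have xE : x = X.`_3 by rewrite /x AE morph_constt // fA.
have yE : y = Y.`_3 by rewrite /y BE morph_constt // fB.
have fc : f c = [~ x, y] by rewrite morphR.
have xZ : x ^ Z = x ^+ al by rewrite xE -consttJ XZ' consttX.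
have yZ : y ^ Z^-1 = y ^+ al by rewrite yE -consttJ YZ' consttX.
have cZ : [~ x, y] ^ Z = [~ x, y].
  (* Taking 3-parts turns [[~ X, Y] = Z ^+ gamma] into a formula for [[~ x, y]], and [Z] centralises
     the 3-part of its own power. *)
  have -> : [~ x, y] = (Z ^+ gamma).`_3.
    rewrite -fc Zg /c AE BE -[A.`_3]/(phi A) -[B.`_3]/(phi B) -morphR //=.
    rewrite morph_constt ?groupR //.
    by rewrite morphR // fA fB.
  by rewrite -consttJ conjXg conjgE mulKg.
have xc : x ^ [~ x, y] = x ^+ d by rewrite -fc -morphJ ?groupR // ac morphX.
have yc : y ^ [~ x, y]^-1 = y ^+ d.
  by rewrite -fc -morphV ?groupR // -morphJ ?groupV ?groupR // bc morphX.
have xN : x ^+ (3 ^ K.+1) = 1 by rewrite -morphX // aN morph1.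
have yN : y ^+ (3 ^ K.+1) = 1 by rewrite -morphX // bN morph1.
have [be albe] : exists be, (al * be = 1 %[mod 3 ^ K.+1])%N.
  by apply: inverse_mod; rewrite coprimeXr // coprime_sym prime_coprime // /dvdn al2.
have [x9 y3 c3] := macdonald_3 (erefl [~ x, y]) xc yc K3 xN yN d7 de1 al2 albe xZ yZ cZ.
have x3 : x ^+ 3 != 1.
  have [hT [px [py [pz [pxz pyz pzg [px9 py9] px3]]]]] := relW_model al2 d7.
  have [h [hM hX hY hZ]] := univW hT px py pz
    (And3 (etrans pxz (esym (expgz_alpha _ _ _ L9 px9)))
          (etrans pyz (esym (expgz_alpha _ _ _ L9 py9))) pzg).
  apply: contraNneq px3 => x3; pose hm := Morphism hM.
  have <- : hm x = px.
    rewrite xE morph_constt //= hX constt_p_elt // /p_elt (pnat_dvd (_ : _ %| 9)%N) //.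
    by rewrite order_dvdn px9.
  by rewrite -morphX ?x3 ?morph1 // xE groupX.
have y9 : y ^+ 9 = 1 by rewrite (expgM y 3 3 : y ^+ 9 = _) y3 -expgM x9.
have QE : f @* G3 = <<[set x; y]>>.
  have -> : f @* G3 = f @* <<[set a; b]>> by rewrite -G3E.
  by rewrite morphim_gen ?subUset ?sub1set ?Ga // morphimU !morphim_set1.
have oQ : #|f @* G3| = 81.
  by rewrite QE; apply: (card_macdonald_3 (erefl [~ x, y]) xc yc K3 d7 de1).
have N3E : N3 = 'ker_G3 f by rewrite /N3 setIC.
have isoQ : G3 / N3 \isog f @* G3 by rewrite N3E first_isog_loc.
have oN3 : #|N3| = (3 ^ 6)%N.
  have nN : G3 \subset 'N('ker_G3 f).
    by rewrite normsI ?normG // (subset_trans sG3G) ?ker_norm.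
  have := card_isog isoQ; rewrite N3E card_quotient // oQ => iN.
  have := Lagrange (subsetIl G3 ('ker f)); rewrite iN oG3 => /eqP.
  by rewrite (_ : 3 ^ 10 = 3 ^ 6 * 81)%N // eqn_pmul2r // => /eqP.
have N3gen : N3 = <<[set a ^+ 3 * b ^- 3; a ^+ 9; b ^+ 9; c ^+ 3]>>.
  have Gc : c \in G3 by rewrite groupR.
  have sMN : <<[set a ^+ 3 * b ^- 3; a ^+ 9; b ^+ 9; c ^+ 3]>> \subset N3.
    rewrite gen_subG; apply/subsetP=> u u_gen; rewrite in_setI; apply/andP; split.
      apply/kerP; move: u_gen; rewrite !inE -!orbA => /or4P[] /eqP->;
        rewrite ?groupM ?groupV ?groupX ?groupR //.
      - by rewrite morphM ?groupV ?groupX // morphV ?groupX // !morphX // -/x -/y y3 mulgV.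
      - by rewrite morphX.
      - by rewrite morphX.
      by rewrite morphX ?groupR // fc.
    by move: u_gen; rewrite !inE -!orbA => /or4P[] /eqP->;
      rewrite ?groupM ?groupV ?groupX.
  (* The order of the generated subgroup divides [3 ^ 6] and exceeds [3 ^ 5]. *)
  apply/esym/eqP; rewrite eqEcard sMN oN3.
  have := cardSg sMN; rewrite oN3 => /dvdn_pfactor[] // m le_m oM.
  have := card_macdonald_sub (erefl c) ac bc K3 aN bN d7 de1 a27.
  by rewrite oM ltn_exp2l // leq_exp2l.
split=> //.
- by rewrite W3E isog_sym.
split; first by rewrite W3E.
exists x, y, [~ x, y].
have W3xy : W3 :=: <<[set x; y]>> by rewrite W3E.
apply: (presented3_relW3 _ presG _ _ sG3G G3a G3b (erefl x) (erefl y)) => //.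
- have [r r1 ar] := constt_expg 3 A; exists r; rewrite AE; split=> //.
  move: r1; rewrite -AE (order_macdonald_27 (erefl c) ac bc K3 aN bN d7 de1 a27) => r1.
  by rewrite -(@modn_dvdm 81 r 9) // r1.
- have [r r1 br] := constt_expg 3 B; exists r; rewrite BE; split=> //.
  move: r1; rewrite -BE (order_macdonald_27b (erefl c) ac bc K3 aN bN d7 de1 a27) => r1.
  by rewrite -(@modn_dvdm 81 r 9) // r1.
- by rewrite W3E.
- have Vx : x \in <<[set x; y]>> by rewrite mem_gen ?set21.
  have Vy : y \in <<[set x; y]>> by rewrite mem_gen ?set22.
  apply/eqP; rewrite W3xy eqEsubset genS ?subsetUl //= gen_subG !subUset !sub1set.
  by rewrite Vx Vy groupR.
split=> //.
(* Modulo 9, [d] is 7, that is -2, and the inverse [e] is 4. *)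
- rewrite xc; apply/eqP; rewrite eq_sym eq_invg_mul -expgD -(expg_mod _ x9).
  by rewrite -modnDmr d7.
rewrite -[y in LHS]expg1 (conjb yc yN de1) muln1.
exact: (expg_modl y9).
Qed.
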